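(* Let $(\mathscr{D},H,\bar{\mathscr{D}}')$ be a rigged Hilbert space and assume that $(\mathscr{D},\tau_{\mathscr{A}})$ is a barrelled space. Let $I:=I_{\mathscr{D},\bar{\mathscr{D}}'}:\mathscr{D}\to\bar{\mathscr{D}}'$ be the natural inclusion operator. Then for every positive operator $A\in\mathscr{L}(\mathscr{D};\bar{\mathscr{D}}')$ the operator $$A_r=(I-I:A)_{I}-I$$ is regular, and the decomposition $$A=A_r+(A-A_r)$$ is a Lebesgue-type decomposition; that is, $A_r$ is regular and $A-A_r$ is singular.
   Context: Rigged Hilbert space: let $\mathscr{D}$ be a dense linear subspace of a complex Hilbert space $H$ and let $\mathcal{L}^{\dagger}(\mathscr{D})$ be the $^*$-algebra of all linear operators $T:\mathscr{D}\to H$ with $\mathscr{D}\subseteq\operatorname{dom}T^*$, $T(\mathscr{D})\subseteq\mathscr{D}$, $T^*(\mathscr{D})\subseteq\mathscr{D}$, with involution $T^\dagger:=T^*|_{\mathscr{D}}$. Let $\mathscr{A}$ be a $\dagger$-closed subalgebra of $\mathcal{L}^\dagger(\mathscr{D})$ containing the identity operator, and equip $\mathscr{D}$ with the locally convex topology $\tau_{\mathscr{A}}$ induced by the seminorms $|||x|||_T:=(\|x\|^2+\|Tx\|^2)^{1/2}$, $T\in\mathscr{A}$. Let $\bar{\mathscr{D}}'$ be the topological anti-dual (continuous conjugate-linear functionals) of $(\mathscr{D},\tau_{\mathscr{A}})$, endowed with the strong dual topology $\beta'=\beta(\bar{\mathscr{D}}',\mathscr{D})$. Then $(\mathscr{D},\tau_{\mathscr{A}})\hookrightarrow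 H\hookrightarrow(\bar{\mathscr{D}}',\beta')$ continuously, and $(\mathscr{D},H,\bar{\mathscr{D}}')$ is called a rigged Hilbert space. $\langle\cdot,\cdot\rangle:\bar{\mathscr{D}}'\times\mathscr{D}\to\mathbb{C}$ is the natural pairing $\langle\varphi,x\rangle=\varphi(x)$. $\mathscr{L}(\mathscr{D};\bar{\mathscr{D}}')$ is the set of linear operators $\mathscr{D}\to\bar{\mathscr{D}}'$ that are continuous (for $\tau_{\mathscr{A}}$ and $\beta'$, equivalently, in the barrelled case, for the weak topologies $\sigma(\mathscr{D},\bar{\mathscr{D}}')$ and $\sigma(\bar{\mathscr{D}}',\mathscr{D})$). $A$ is positive if $\langle Ax,x\rangle\geq0$ for all $x\in\mathscr{D}$; $A\leq A'$ means $A'-A$ is positive. The natural inclusion $I_{\mathscr{D},\bar{\mathscr{D}}'}:\mathscr{D}\to\bar{\mathscr{D}}'$ is $x\mapsto(x\,|\,\cdot)$, where $(\cdot\,|\,\cdot)$ is the inner product of $H$ (linear in the first variable); it is a positive operator. Complement: for positive $A,B\in\mathscr{L}(\mathscr{D};\bar{\mathscr{D}}')$ the complement $A_B$ of $A$ with respect to $B$ is the smallest positive operator $C\in\mathscr{L}(\mathscr{D};\bar{\mathscr{D}}')$ such that the operator matrix $\begin{bmatrix} A & B \\ B & C \end{bmatrix}:\mathscr{D}\times\mathscr{D}\to\bar{\mathscr{D}}'\times\bar{\mathscr{D}}'$ is positive (the pairing on products being the sum of the pairings). It exists if and only if for every $y\in\mathscr{D}$ there is $M_y\geq0$ with $|\langle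 Bx,y\rangle|^2\leq M_y\langle Ax,x\rangle$ for all $x\in\mathscr{D}$, and then $\langle A_By,y\rangle=\sup\{\langle By,x\rangle+\langle Bx,y\rangle-\langle Ax,x\rangle:x\in\mathscr{D}\}$. Parallel sum: for positive $A,B\in\mathscr{L}(\mathscr{D};\bar{\mathscr{D}}')$, $A:B:=A-(A+B)_A$, a positive operator with $\langle(A:B)y,y\rangle=\inf\{\langle A(y+x),y+x\rangle+\langle Bx,x\rangle:x\in\mathscr{D}\}$. A positive operator $A\in\mathscr{L}(\mathscr{D};\bar{\mathscr{D}}')$ is called regular if for every sequence $(x_n)$ in $\mathscr{D}$, $\|x_n\|\to0$ and $\langle A(x_n-x_m),x_n-x_m\rangle\to0$ ($n,m\to\infty$) imply $\langle Ax_n,x_n\rangle\to0$. It is called singular if for every $x\in\mathscr{D}$ there exists a sequence $(x_n)$ in $\mathscr{D}$ such that $\|x_n-x\|\to0$ and $\langle Ax_n,x_n\rangle\to0$. *)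

(* Defs.v *)
From HB Require Import structures.
From mathcomp Require Import all_boot all_order all_algebra.
From mathcomp Require Import sesquilinear.
From mathcomp Require Export complex.
From mathcomp Require Import all_classical all_reals all_analysis.
Export numFieldNormedType.Exports.
Set Implicit Arguments.
Unset Strict Implicit.
Unset Printing Implicit Defensive.
Import Order.TTheory GRing.Theory Num.Theory.
Local Open Scope classical_set_scope.
Local Open Scope complex_scope.
Local Open Scope ring_scope.

(* The libraries topologize R[i] only under its alias R[i]^o. *)
HB.instance Definition _ (R : realType) := NormedModule.copy R[i] R[i]^o.

(* V with the locally convex topology induced by a family P of seminorms: the
   open P-balls form a subbase.  Seminorms are R[i]-valued, like the norm of
   a normedModType R[i]. *)
Definition seminormed (C : numFieldType) (V : lmodType C) (P : set (V -> C)) :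
  Type := V.

Definition open_seminorm_balls (C : numFieldType) (V : lmodType C)
    (P : set (V -> C)) : set (set V) :=
  [set B | exists p x e, [/\ P p, 0 < e & B = [set y | p (y - x) < e]]].

HB.instance Definition _ (C : numFieldType) (V : lmodType C)
  (P : set (V -> C)) := GRing.Lmodule.on (seminormed P).

HB.instance Definition _ (C : numFieldType) (V : lmodType C)
  (P : set (V -> C)) :=
  isSubBaseTopological.Build (seminormed P) (open_seminorm_balls P) id.

Section Barrelled.
Variables (R : realType) (V : preTopologicalLmodType R[i]).

Definition absolutely_convex (B : set V) :=
  forall (a b : R[i]) x y, `|a| + `|b| <= 1 -> B x -> B y ->
  B (a *: x + b *: y).

Definition absorbing (B : set V) :=
  forall x, exists2 r : R[i], 0 < r & forall a : R[i], `|a| <= r -> B (a *: x).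

Definition barrel (B : set V) :=
  [/\ absolutely_convex B, absorbing B & closed B].

Definition barrelled := forall B, barrel B -> nbhs 0 B.

End Barrelled.
Arguments barrelled {R} V.

Section RiggedHilbertSpace.
Variables (R : realType) (H : completeNormedModType R[i]).
(* {dot H for conjC} is linear in its first variable. *)
Variable dot : {dot H for (@Num.conj R[i])}.

(* H is complete for its norm, so this makes it a Hilbert space. *)
Definition norm_of_dot := forall x : H, dot x x = `|x| ^+ 2.

Variables (S : {pred H}) (D : subLmodType S).

(* z = T^* y; for T : D -> D the inclusion T(D) <= D is part of the typing. *)
Definition adjoint_value (T : D -> D) (y z : H) :=
  forall x : D, dot (val (T x)) y = dot (val x) z.

Definition adjoint_dom (T : D -> D) : set H :=
  [set y | exists z, adjoint_value T y z].

Definition Ldagger : set (D -> D) :=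
  [set T | [/\ linear T,
               [set x | x \in S] `<=` adjoint_dom T &
               forall y z, y \in S -> adjoint_value T y z -> z \in S]].

(* T' = T^dagger, the restriction of T^* to D *)
Definition dagger (T T' : D -> D) :=
  forall y : D, adjoint_value T (val y) (val (T' y)).

Record unital_dagger_subalgebra (AA : set (D -> D)) : Prop := {
  uds_sub : AA `<=` Ldagger ;
  uds_id : AA id ;
  uds_add : forall T U, AA T -> AA U -> AA (fun x => T x + U x) ;
  uds_scale : forall (a : R[i]) T, AA T -> AA (fun x => a *: T x) ;
  uds_comp : forall T U, AA T -> AA U -> AA (T \o U) ;
  uds_dagger : forall T T', AA T -> dagger T T' -> AA T' }.

Definition graph_seminorm (T : D -> D) (x : D) : R[i] :=
  sqrtC (`|val x : H| ^+ 2 + `|val (T x) : H| ^+ 2).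

Variable AA : set (D -> D).

(* (D, tau_AA) *)
Definition Dtau := seminormed (graph_seminorm @` AA).
HB.instance Definition _ := GRing.Lmodule.on Dtau.
HB.instance Definition _ := Topological.on Dtau.

Definition antidual : set (D -> R[i]) :=
  [set phi | (forall (a : R[i]) (x y : D), phi (a *: x + y) = a^* * phi x + phi y) /\
             continuous (phi : Dtau -> R[i])].

Definition weakly_bounded (B : set D) :=
  forall phi, antidual phi -> exists M : R[i], forall x, B x -> `|phi x| <= M.

(* Operators D -> antidual are curried, so that A x y is the pairing <A x, y>.
   The strong topology beta(antidual, D) is the trace on the antidual of the
   topology of uniform convergence on the weakly bounded subsets of D. *)
Definition Lop : set (D -> D -> R[i]) :=
  [set A | [/\ forall x : D, antidual (A x),
               linear (A : D -> (D -> R[i])) &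
               continuous (A : Dtau -> {family weakly_bounded, D -> R[i]})]].

Definition posop (V : Type) (A : V -> V -> R[i]) := forall x, 0 <= A x x.

Definition leop (A A' : D -> D -> R[i]) := posop (A' - A).

Definition natural_inclusion (x y : D) : R[i] := dot (val x) (val y).

(* the operator matrix [A11 A12; A21 A22], with the sum pairing on D * D *)
Definition opmx (A11 A12 A21 A22 : D -> D -> R[i]) (u v : D * D) : R[i] :=
  (A11 u.1 + A12 u.2) v.1 + (A21 u.1 + A22 u.2) v.2.

Definition complement_candidate (A B : D -> D -> R[i]) :
    set (D -> D -> R[i]) :=
  [set C | [/\ Lop C, posop C & posop (opmx A B B C)]].

Definition is_complement (A B C : D -> D -> R[i]) :=
  complement_candidate A B C /\
  forall C', complement_candidate A B C' -> leop C C'.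

(* A_B; it has a meaning only if is_complement A B has a solution. *)
Definition complement (A B : D -> D -> R[i]) : D -> D -> R[i] :=
  xget 0 (is_complement A B).

Definition parallel_sum (A B : D -> D -> R[i]) : D -> D -> R[i] :=
  A - complement (A + B) A.

Definition regular (A : D -> D -> R[i]) :=
  [/\ Lop A, posop A &
   forall x_ : nat -> D,
     `|val (x_ n) : H| @[n --> \oo] --> (0 : R[i]) ->
     A (x_ nm.1 - x_ nm.2) (x_ nm.1 - x_ nm.2) @[nm --> (\oo, \oo)]
       --> (0 : R[i]) ->
     A (x_ n) (x_ n) @[n --> \oo] --> (0 : R[i])].

Definition singular (A : D -> D -> R[i]) :=
  [/\ Lop A, posop A &
   forall x : D, exists x_ : nat -> D,
     `|val (x_ n - x) : H| @[n --> \oo] --> (0 : R[i]) /\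
     A (x_ n) (x_ n) @[n --> \oo] --> (0 : R[i])].

Definition lebesgue_decomposition (A Ar As : D -> D -> R[i]) :=
  [/\ A = Ar + As, regular Ar & singular As].

End RiggedHilbertSpace.
Arguments natural_inclusion {R H} dot {S} D x y.

(* Main.v *)
(** Write [h] for the form of [I], [s = h + A], [c1] for the form of [(I + A)_I]
    and [c2] for that of [(I - I:A)_I].  Since [I - I:A = (I + A)_I], the supremum
    formula for complements says that [c1] and [c2] are the first and the second
    Fenchel conjugate of [s] with respect to the pairing [h]; thus
    [c1 <= h <= c2 <= s] and [c2] is the lower semicontinuous hull of [s] for the
    Hilbert norm.  Lower semicontinuity of [c2] makes [A_r = c2 - h] regular.
    Conversely every [y] is a norm limit of [z_n] with [s[z_n] -> c2[y]], and by
    lower semicontinuity [s[z_n] - c2[z_n] -> 0], so that [A - A_r = s - c2] is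
    singular.  Barrelledness enters only to show that a positive form dominated
    by [s] is a continuous operator into the strong anti-dual. *)

From HB Require Import structures.
Require Import Defs.
From mathcomp Require Import all_boot all_order all_algebra.
From mathcomp Require Import sesquilinear.
From mathcomp Require Import all_classical all_reals all_analysis.
From mathcomp Require Import ring lra.

Set Implicit Arguments.
Unset Strict Implicit.
Unset Printing Implicit Defensive.
Import Order.TTheory GRing.Theory Num.Theory.
Local Open Scope classical_set_scope.
Local Open Scope complex_scope.
Local Open Scope ring_scope.

(** * Real quadratic forms and their conjugates *)

Record sym_bilinear (R : realType) (V : lmodType R) (a : V -> V -> R) : Prop := {
  sformC : forall x y, a x y = a y x ;
  sformD : forall x y z, a (x + y) z = a x z + a y z ;
  sformZ : forall k x z, a (k *: x) z = k * a x z }.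

Section SymmetricForm.
Variables (R : realType) (V : lmodType R) (a : V -> V -> R).
Hypothesis sa : sym_bilinear a.

Lemma sformDr x y z : a x (y + z) = a x y + a x z.
Proof. by rewrite (sformC sa) (sformD sa) !(sformC sa _ x). Qed.

Lemma sformZr k x z : a x (k *: z) = k * a x z.
Proof. by rewrite (sformC sa) (sformZ sa) (sformC sa x). Qed.

Lemma sformN x z : a (- x) z = - a x z.
Proof. by rewrite -scaleN1r (sformZ sa) mulN1r. Qed.

Lemma sformNr x z : a x (- z) = - a x z.
Proof. by rewrite (sformC sa) sformN (sformC sa x). Qed.

Definition sformE :=
  (sformD sa, sformDr, sformN, sformNr, sformZ sa, sformZr).

End SymmetricForm.

(** * The Jordan-von Neumann theorem for nonnegative functions *)

Section JordanVonNeumann.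
Variables (R : realType) (V : lmodType R) (q : V -> R).
Hypothesis q_ge0 : forall x, 0 <= q x.
Hypothesis qZ : forall k x, q (k *: x) = k ^+ 2 * q x.
Hypothesis q_parallelogram : forall x y, q (x + y) + q (x - y) = 2 * q x + 2 * q y.

Definition polar_form x y := (q (x + y) - q x - q y) / 2.

Lemma polar_formxx x : polar_form x x = q x.
Proof.
have h : x + x = 2 *: x by rewrite scaler_nat mulr2n.
by rewrite /polar_form h qZ {h}; field.
Qed.

Lemma polar_formC x y : polar_form x y = polar_form y x.
Proof. by rewrite /polar_form (addrC x); lra. Qed.

(** In [h1 + h3 - h2] the values at [x + z - y] and [x + y - z] cancel, and [h4] trades [q (z - y)]
    for [q (y + z)]. *)
Lemma polar_formD x y z : polar_form (x + y) z = polar_form x z + polar_form y z.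
Proof.
have h1 := q_parallelogram (x + z) y.
have h2 := q_parallelogram x (z - y).
have h3 := q_parallelogram (x + y) z.
have h4 := q_parallelogram z y.
rewrite addrAC in h1; rewrite addrA opprB addrA in h2.
by rewrite /polar_form (addrC y z); lra.
Qed.

(* Additivity makes the defect [g] of homogeneity additive and zero on integers;
   positivity of [q] bounds it below, so it vanishes. *)
Lemma polar_formZ k x z : polar_form (k *: x) z = k * polar_form x z.
Proof.
pose g t := polar_form (t *: x) z - t * polar_form x z.
have gD s t : g (s + t) = g s + g t.
  by rewrite /g scalerDl polar_formD; lra.
have g1 : g 1 = 0 by rewrite /g scale1r mul1r subrr.
have g0 : g 0 = 0 by have := gD 0 0; rewrite addr0; lra.
have gN t : g (- t) = - g t by have := gD t (- t); rewrite subrr g0; lra.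
have gMn t n : g (t *+ n) = g t *+ n.
  by elim: n => [|n IH]; rewrite ?mulr0n// !mulrS gD IH.
have gint (m : int) : g m%:~R = 0.
  by case: m => n; rewrite ?NegzE ?mulrNz ?gN -pmulrn gMn g1 mul0rn ?oppr0.
pose C := q x + q z + `|polar_form x z|.
have gC t : - C <= g t.
  (* [g] has period 1, so only a factor [s] in [0, 1] matters; there [polar_form (s *: x) z >= - (q
     x + q z) / 2]. *)
  have -> : g t = g (t - (Num.floor t)%:~R) by rewrite gD gN gint subr0.
  have /andP[] := floor_itv t.
  set s := t - _ => h1 h2.
  have s0 : 0 <= s by rewrite /s subr_ge0.
  have s1 : s <= 1 by rewrite /s; move: h2; rewrite intrD; lra.
  have sX : s ^+ 2 * q x <= q x by rewrite ler_piMl// expr_le1.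
  have sp : s * polar_form x z <= `|polar_form x z|.
    by rewrite (le_trans (ler_norm _))// normrM ger0_norm// ler_piMl.
  have := q_ge0 (s *: x + z); have := q_ge0 z; have := q_ge0 x.
  by rewrite /g /C [polar_form (s *: x) z]/polar_form qZ; lra.
suff : g k = 0 by rewrite /g; lra.
have C0 : 0 <= C by rewrite /C !addr_ge0.
(* If [g t > 0], additivity pushes [g] below [- C] at a large multiple of [- t]. *)
have gle t : g t <= 0.
  rewrite leNgt; apply/negP => gt.
  have [n nC] : exists n, C < g t *+ n.
    exists (Num.bound (C / g t)); rewrite -mulr_natr mulrC -ltr_pdivrMr//.
    by apply: le_lt_trans (archi_boundP _); rewrite ?divr_ge0// ltW.
  by have := gC (- t *+ n); rewrite gMn gN mulNrn; lra.
by apply/eqP; rewrite eq_le gle /=; have := gle (- k); rewrite gN; lra.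
Qed.

Lemma polar_form_symmetric : sym_bilinear polar_form.
Proof. by split; [exact: polar_formC|exact: polar_formD|exact: polar_formZ]. Qed.

End JordanVonNeumann.

(* [c y y] is the supremum of [2 * b x y - a x x] over [x], as for [c = a_b]. *)
Definition fenchel_conjugate (R : realType) (V : lmodType R)
    (a b c : V -> V -> R) :=
  (forall x y, 2 * b x y - a x x <= c y y) /\
  (forall y e, 0 < e -> exists x, c y y <= 2 * b x y - a x x + e).

Section FenchelForm.
Variables (R : realType) (V : lmodType R) (a b : V -> V -> R).
Hypotheses (sa : sym_bilinear a) (sb : sym_bilinear b).
Hypothesis a_ge0 : forall x, 0 <= a x x.
Hypothesis bounded_ab : forall y, exists M, forall x, 2 * b x y - a x x <= M.

Let E y := range (fun x => 2 * b x y - a x x).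
Let q y := sup (E y).

Let E_sup y : has_sup (E y).
Proof.
split; first by exists (2 * b 0 y - a 0 0), 0.
by have [M hM] := bounded_ab y; exists M => _ [x _ <-].
Qed.

Let q_ub x y : 2 * b x y - a x x <= q y.
Proof. by apply: ub_le_sup; [exact: (E_sup y).2|exists x]. Qed.

Let q_approx y e : 0 < e -> exists x, q y <= 2 * b x y - a x x + e.
Proof.
move=> e0; have [_ [x _ <-]] := sup_adherent e0 (E_sup y).
by rewrite ltrBlDr => /ltW h; exists x.
Qed.

Let q_ge0 y : 0 <= q y.
Proof. by have := q_ub (0 *: y) y; rewrite !(sformE sa) !(sformE sb); lra. Qed.

(** Substituting [k *: x] for [x] scales the expression under the supremum by [k ^+ 2]. The reverse
    inequality is this one for [k^-1]. *)
Let qZ_le k y : k != 0 -> q (k *: y) <= k ^+ 2 * q y.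
Proof.
move=> k0; apply/ler_addgt0Pr => e e0.
have [x hx] := q_approx (k *: y) e0.
have := q_ub (k^-1 *: x) y; rewrite !(sformE sa) (sformZ sb) => h.
apply: (le_trans hx); rewrite lerD2r (sformZr sb).
have -> : 2 * (k * b x y) - a x x =
  k ^+ 2 * (2 * (k^-1 * b x y) - k^-1 * (k^-1 * a x x)) by field.
by apply: ler_wpM2l => //; rewrite sqr_ge0.
Qed.

Let q_zero : q 0 = 0.
Proof.
apply/eqP; rewrite eq_le q_ge0 andbT; apply/ler_addgt0Pr => e e0.
have [x] := q_approx 0 e0; rewrite -(scale0r 0) (sformZr sb).
by have := a_ge0 x; lra.
Qed.

Let qZ k y : q (k *: y) = k ^+ 2 * q y.
Proof.
have [->|k0] := eqVneq k 0; first by rewrite scale0r expr0n mul0r q_zero.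
apply/eqP; rewrite eq_le qZ_le//=.
have := @qZ_le k^-1 (k *: y); rewrite invr_neq0// => /(_ isT).
rewrite scalerA mulVf// scale1r -(@ler_pM2l _ (k ^+ 2)) ?exprn_even_gt0//.
by rewrite mulrA -exprMn mulfV// expr1n mul1r.
Qed.

(** Near maximizers [u] at [x] and [v] at [y] give the test vectors [u + v] at [x + y] and [u - v]
    at [x - y]; the parallelogram law of [a] does the rest. *)
Let q_parallelogram_le x y : 2 * q x + 2 * q y <= q (x + y) + q (x - y).
Proof.
apply/ler_addgt0Pr => e e0; have e4 : 0 < e / 4 by rewrite divr_gt0.
have [u hu] := q_approx x e4; have [v hv] := q_approx y e4.
have := q_ub (u + v) (x + y); have := q_ub (u - v) (x - y).
by rewrite !(sformE sa) !(sformE sb) (sformC sa v u); lra.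
Qed.

Let q_parallelogram x y : q (x + y) + q (x - y) = 2 * q x + 2 * q y.
Proof.
apply/eqP; rewrite eq_le q_parallelogram_le andbT.
(* The reverse inequality is the same one at [x + y] and [x - y], whose sum and difference are
   [2 *: x] and [2 *: y]. *)
have := q_parallelogram_le (x + y) (x - y).
have -> : x + y + (x - y) = 2 *: x.
  by rewrite addrACA subrr addr0 scaler_nat mulr2n.
have -> : x + y - (x - y) = 2 *: y.
  by rewrite opprB addrC addrA subrK scaler_nat mulr2n.
by rewrite !qZ; lra.
Qed.

Lemma fenchel_conjugate_exists :
  exists c, [/\ sym_bilinear c, forall y, 0 <= c y y & fenchel_conjugate a b c].
Proof.
exists (polar_form q); split; last split.
- exact: polar_form_symmetric.
- by move=> y; rewrite polar_formxx.
- by move=> x y; rewrite polar_formxx.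
- by move=> y e e0; rewrite polar_formxx//; exact: q_approx.
Qed.

End FenchelForm.

(** * Second conjugates: relaxation and lower semicontinuity *)

Section Biconjugate.
Variables (R : realType) (V : lmodType R) (h s c1 c2 : V -> V -> R).
Hypotheses (symh : sym_bilinear h) (h_ge0 : forall x, 0 <= h x x).
Hypothesis le_hs : forall x, h x x <= s x x.
Hypotheses (symc1 : sym_bilinear c1) (c1_ge0 : forall x, 0 <= c1 x x).
Hypothesis c1_conj : fenchel_conjugate s h c1.
Hypothesis c2_conj : fenchel_conjugate c1 h c2.

(** This is [h[t x - y] >= 0] divided by [t]. A small [t] makes the first term negligible, and the
    second is small once [h y y] is small against [t]. *)
Lemma young_form t x y : 0 < t -> 2 * h x y <= t * h x x + h y y / t.
Proof.
move=> t0; have := h_ge0 (t *: x - y).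
rewrite !(sformE symh) (sformC symh y x) => hh.
rewrite -(ler_pM2l t0) mulrDr (mulrCA t (h y y)) mulfV ?gt_eqF// mulr1.
by lra.
Qed.

(** Conjugation reverses the order, and [h] is its own conjugate. *)
Lemma conjugate_le_form y : c1 y y <= h y y.
Proof.
apply/ler_addgt0Pr => e /(c1_conj.2 y)[x].
have := young_form x y ltr01; have := le_hs x; lra.
Qed.

Lemma form_le_biconjugate y : h y y <= c2 y y.
Proof. by have := c2_conj.1 y y; have := conjugate_le_form y; lra. Qed.

Lemma biconjugate_le y : c2 y y <= s y y.
Proof.
apply/ler_addgt0Pr => e /(c2_conj.2 y)[x].
by have := c1_conj.1 y x; rewrite (sformC symh y); lra.
Qed.

(* [x] almost maximizes [2 h(x, y) - c1[x] - k h[x]] and [z] almost maximizes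
   [2 h(z, x) - s[z]], so that [y] is nearly [z + k x]. *)
Lemma relaxation y k : 0 < k -> k <= 1 -> exists z,
  s z z <= c2 y y + 7 * k /\ h (y - z) (y - z) <= (2 * c2 y y + 14) * k.
Proof.
move=> k0 k1.
(* The conjugate [c] of [c1 + k h] is a Moreau-type regularization of [c2]; the penalty keeps
   [k * h x x] bounded for near maximizers [x]. *)
pose a u v := c1 u v + k * h u v.
have syma : sym_bilinear a.
  split=> *; rewrite /a ?(sformE symh, sformE symc1) 1?(sformC symh).
  - by rewrite (sformC symc1).
  - by lra.
  - by lra.
have a_ge0 u : 0 <= a u u by rewrite addr_ge0// mulr_ge0// ltW.
have bnd w : exists M, forall u, 2 * h u w - a u u <= M.
  exists (c2 w w) => u; have := c2_conj.1 u w.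
  by have : 0 <= k * h u u by [rewrite mulr_ge0// ltW]; rewrite /a; lra.
have [c [_ _ [cub capp]]] := fenchel_conjugate_exists syma symh a_ge0 bnd.
(* Accuracy of order [k ^+ 2] is required because the estimate of [s z z] comes multiplied by
   [k]. *)
have kk : 0 < k ^+ 2 by rewrite exprn_gt0.
have [x hx] := capp y _ kk.
have [z hz] := c1_conj.2 x _ kk.
have [d dE] : exists d, d = y - z - k *: x by eexists.
have hd : h d d <= 6 * k ^+ 2.
  (* Near stationarity: moving [x] to [x + w] in the first problem and to [x - w] in the second
     gives [2 h(w, d) <= 2 k^2 + 3 h[w]]. The choice [w = d / 3] is optimal and yields the constant
     6. *)
  have [w wE] : exists w, w = 3^-1 *: d by eexists.
  have e1 := cub (x + w) y; have e2 := c1_conj.1 z (x - w).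
  have e3 := conjugate_le_form w.
  have e4 : k * h w w <= h w w by rewrite ler_piMl.
  have e5 : h w d = h w y - h w z - k * h w x by rewrite dE !(sformE symh).
  have e6 : h w d = 3 * h w w by rewrite {3}wE !(sformE symh); field.
  have e7 : 3 * h w d = h d d by rewrite wE !(sformE symh); field.
  move: e1 e2 hx; rewrite /a !(sformE symh) !(sformE symc1).
  by rewrite (sformC symc1 w x) (sformC symh x w) (sformC symh z w); lra.
have hkx : k * h x x <= c2 y y + k ^+ 2.
  (* Testing [c] at 0 gives [0 <= c y y], which caps the penalty. *)
  have := cub 0 y; have := c2_conj.1 x y; move: hx.
  by rewrite -(scale0r 0) /a !(sformE symh) !(sformE symc1); lra.
have ydz : y - z = d + k *: x by rewrite dE subrK.
have hkkx : k * (k * h x x) <= k * (c2 y y + k ^+ 2) by rewrite ler_pM2l.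
have kkk : k ^+ 2 <= k by rewrite expr2 ler_piMl// ltW.
exists z; split; last first.
  have := h_ge0 (d - k *: x).
  rewrite ydz !(sformE symh) (sformC symh x d) => hm.
  have : k * k ^+ 2 <= k.
    by rewrite (le_trans _ kkk)// expr2 ler_pM2l// (le_trans kkk).
  lra.
have hzx : h z x = h y x - k * h x x - h d x.
  by rewrite dE !(sformE symh); lra.
(* This bounds [- 2 k h(d, x)] by [h[d] + k^2 h[x]]. The first term is at most [6 k^2], and the
   second is absorbed by the [- 2 k^2 h[x]] that [hzx] produces. *)
have := h_ge0 (d + k *: x); rewrite !(sformE symh) (sformC symh x d) => hp.
have := c2_conj.1 x y; rewrite (sformC symh x y) => c2x.
rewrite -(ler_pM2l k0).
have : k * s z z <= k * (2 * h z x - c1 x x + k ^+ 2).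
  by rewrite ler_pM2l//; lra.
have : k * (2 * h y x - c1 x x) <= k * c2 y y by rewrite ler_pM2l.
have : k * k ^+ 2 <= k ^+ 2 by rewrite ler_piMl// ltW.
have : 0 <= k * (k * h x x) by rewrite !mulr_ge0 // ltW.
rewrite hzx; lra.
Qed.

(** [relaxation] puts [s z z] at most slightly above [c2 y y], and a fixed near maximizer [x] for
    [c2 y y] shows that [c2 z z] is not much below it. The error [e] is shared equally by the choice
    of [x], the two Young terms and [7 * k]. *)
Lemma singular_part_approx y e : 0 < e -> exists z,
  h (y - z) (y - z) <= e /\ s z z - c2 z z <= e.
Proof.
move=> e0; have e4 : 0 < e / 4 by rewrite divr_gt0.
have [x hx] := c2_conj.2 y _ e4.
have hx1 : 0 < 1 + h x x by rewrite ltr_wpDr.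
pose t := e / 4 / (1 + h x x).
have t0 : 0 < t by rewrite divr_gt0.
have tx : t * h x x <= e / 4.
  by rewrite /t mulrAC ler_pdivrMr// ler_pM2l// lerDr.
have c0 : 0 < 2 * c2 y y + 14.
  by have := form_le_biconjugate y; have := h_ge0 y; lra.
(* Below [m], the distance [h (y - z) (y - z)] is at most [e], and at most [e / 4] after division by
   [t]. *)
pose m := Num.min e (t * (e / 4)).
have m0 : 0 < m by rewrite lt_min e0 mulr_gt0.
pose k := Num.min 1 (Num.min (e / 28) (m / (2 * c2 y y + 14))).
have k0 : 0 < k by rewrite !lt_min ltr01 !divr_gt0.
have /and3P[k1 ke km] : [&& k <= 1, k <= e / 28 & k <= m / (2 * c2 y y + 14)].
  by rewrite -!le_min.
have [z [sz hz]] := relaxation y k0 k1; exists z.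
have {}hz : h (y - z) (y - z) <= m.
  by rewrite (le_trans hz)// mulrC -ler_pdivlMr.
move: (hz); rewrite le_min => /andP[hze hzt]; split => //.
have := young_form x (y - z) t0.
have : h (y - z) (y - z) / t <= e / 4 by rewrite ler_pdivrMr// mulrC.
have := c2_conj.1 x z; rewrite [h x (y - z)](sformDr symh) (sformNr symh).
by lra.
Qed.

(** A near maximizer [w] for [c2[x_n]] also tests [c2[x_n - x_m]], at the cost of [2 h(w, x_m)],
    which vanishes as [m] grows. The Cauchy hypothesis and [h[x_n - x_m] <= 2 h[x_n] + 2 h[x_m]]
    bound [c2[x_n - x_m]]. *)
Lemma regular_part_closable (x_ : nat -> V) :
  (forall e, 0 < e -> exists N, forall n, (N <= n)%N -> h (x_ n) (x_ n) <= e) ->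
  (forall e, 0 < e -> exists N, forall n m, (N <= n)%N -> (N <= m)%N ->
     c2 (x_ n - x_ m) (x_ n - x_ m) - h (x_ n - x_ m) (x_ n - x_ m) <= e) ->
  forall e, 0 < e -> exists N, forall n, (N <= n)%N -> c2 (x_ n) (x_ n) <= e.
Proof.
move=> x0 xC e e0; have [d dE] : exists d, d = e / 9 by eexists.
have d0 : 0 < d by rewrite dE divr_gt0.
have [N1 hN1] := x0 _ d0; have [N2 hN2] := xC _ d0.
exists (maxn N1 N2) => n; rewrite geq_max => /andP[n1 n2].
have [w hw] := c2_conj.2 (x_ n) _ d0.
have hw1 : 0 < 1 + h w w by rewrite ltr_wpDr.
pose t := d / (1 + h w w).
have t0 : 0 < t by rewrite divr_gt0.
have tw : t * h w w <= d.
  by rewrite /t mulrAC ler_pdivrMr// ler_pM2l// lerDr.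
(* [N3] depends on [w], hence on [n], but it constrains only the auxiliary index [m]; the threshold
   for [n] stays [maxn N1 N2]. *)
have [N3 hN3] := x0 _ (mulr_gt0 d0 t0).
pose m := maxn N1 (maxn N2 N3).
have m1 : (N1 <= m)%N by rewrite leq_max leqnn.
have m2 : (N2 <= m)%N by rewrite !leq_max leqnn orbT.
have m3 : (N3 <= m)%N by rewrite !leq_max leqnn !orbT.
have := hN2 _ _ n2 m2; have := hN1 _ n1; have := hN1 _ m1.
have : h (x_ m) (x_ m) / t <= d by rewrite ler_pdivrMr// hN3.
have := young_form w (x_ m) t0; have := c2_conj.1 w (x_ n - x_ m).
have := h_ge0 (x_ n + x_ m); move: hw.
by rewrite !(sformE symh) (sformC symh (x_ m) (x_ n)); lra.
Qed.

End Biconjugate.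

(** * Positive sesquilinear forms *)

(* Suprema and conjugates only see the real parts of forms, so they are handled
   on the underlying real vector space. *)
Definition realification (R : realType) (V : lmodType R[i]) : Type := V.

HB.instance Definition _ (R : realType) (V : lmodType R[i]) :=
  GRing.Zmodule.on (realification V).

Section Realification.
Variables (R : realType) (V : lmodType R[i]).

Fact realification_scaleA (a b : R) (v : realification V) :
  a%:C *: ((b%:C *: (v : V)) : V) = ((a * b)%:C *: (v : V)) :> V.
Proof. by rewrite scalerA -rmorphM. Qed.

Fact realification_scale1 (v : realification V) : (1 : R)%:C *: (v : V) = v.
Proof. exact: scale1r. Qed.

Fact realification_scaleDr (a : R) (u v : realification V) :
  a%:C *: ((u : V) + v) = a%:C *: (u : V) + a%:C *: (v : V).
Proof. exact: scalerDr. Qed.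

Fact realification_scaleDl (v : realification V) (a b : R) :
  (a + b)%:C *: (v : V) = a%:C *: (v : V) + b%:C *: (v : V).
Proof. by rewrite rmorphD scalerDl. Qed.

HB.instance Definition _ := GRing.Zmodule_isLmodule.Build R (realification V)
  realification_scaleA realification_scale1 realification_scaleDr
  realification_scaleDl.

End Realification.

Record positive_form (R : realType) (V : lmodType R[i]) (a : V -> V -> R[i]) :
  Prop := {
  pform_linear : forall k x y z, a (k *: x + y) z = k * a x z + a y z ;
  pform_antilinear : forall k x y z, a z (k *: x + y) = k^* * a z x + a z y ;
  pform_ge0 : forall x, 0 <= a x x }.

Definition real_form (R : realType) (V : lmodType R[i]) (a : V -> V -> R[i])
  (x y : realification V) : R := complex.Re (a x y).

Lemma complex_ge0 (R : realType) (z : R[i]) :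
  (0 <= z) = (complex.Im z == 0) && (0 <= complex.Re z).
Proof. by case: z. Qed.

Section PositiveForm.
Variables (R : realType) (V : lmodType R[i]) (a : V -> V -> R[i]).
Hypothesis pa : positive_form a.

Lemma pform0l z : a 0 z = 0.
Proof.
have := pform_linear pa 1 0 0 z; rewrite scale1r addr0 mul1r => /eqP.
by rewrite -subr_eq subrr eq_sym => /eqP.
Qed.

Lemma pform0r z : a z 0 = 0.
Proof.
have := pform_antilinear pa 1 0 0 z; rewrite scale1r addr0 conjC1 mul1r => /eqP.
by rewrite -subr_eq subrr eq_sym => /eqP.
Qed.

Lemma pformD x y z : a (x + y) z = a x z + a y z.
Proof. by rewrite -{1}(scale1r x) (pform_linear pa) mul1r. Qed.

Lemma pformZ k x z : a (k *: x) z = k * a x z.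
Proof. by rewrite -(addr0 (k *: x)) (pform_linear pa) pform0l addr0. Qed.

Lemma pformDr x y z : a z (x + y) = a z x + a z y.
Proof. by rewrite -{1}(scale1r x) (pform_antilinear pa) conjC1 mul1r. Qed.

Lemma pformZr k x z : a z (k *: x) = k^* * a z x.
Proof. by rewrite -(addr0 (k *: x)) (pform_antilinear pa) pform0r addr0. Qed.

(** Nonnegative complex numbers are real. Realness at [x + y] gives the identity for imaginary
    parts, and realness at [x + i y] gives it for real parts. *)
Lemma pform_hermitian x y : a y x = (a x y)^*.
Proof.
have h1 := pform_ge0 pa (x + y); have h2 := pform_ge0 pa (x + 'i%C *: y).
have h3 := pform_ge0 pa x; have h4 := pform_ge0 pa y.
move: h1 h2 h3 h4; rewrite !(pformD, pformDr, pformZ, pformZr) !complex_ge0.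
case: (a x x) (a x y) (a y x) (a y y) => [a1 a2] [b1 b2] [c1 c2] [d1 d2] /=.
move=> /andP[/eqP h1 _] /andP[/eqP h2 _] /andP[/eqP h3 _] /andP[/eqP h4 _].
by congr (_ +i* _); lra.
Qed.

Lemma real_form_symmetric : sym_bilinear (real_form a).
Proof.
split.
- by move=> x y; rewrite /real_form pform_hermitian; case: (a y x).
- by move=> x y z; rewrite /real_form pformD; case: (a x z) (a y z) => [? ?] [].
- move=> k x z; rewrite /real_form pformZ; case: (a x z) => u v /=.
  by rewrite mul0r subr0.
Qed.

Lemma real_formE x : a x x = (real_form a x x)%:C.
Proof.
have := pform_ge0 pa x; rewrite complex_ge0 /real_form.
by case: (a x x) => u v /= /andP[/eqP-> _].
Qed.

Lemma real_form_ge0 x : 0 <= real_form a x x.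
Proof. by have := pform_ge0 pa x; rewrite real_formE; rewrite lecR. Qed.

Lemma real_form_i x y : real_form a ('i%C *: x) ('i%C *: y) = real_form a x y.
Proof. by rewrite /real_form pformZ pformZr; case: (a x y) => u v /=; lra. Qed.

(** At [x - t a(x, y) y] with [t] real, the form is a nonnegative real polynomial in [t] with
    coefficients built from [a x x], [N = |a x y|^2] and [a y y]. *)
Lemma cauchy_schwarz x y : `|a x y| ^+ 2 <= a x x * a y y.
Proof.
have hyx := pform_hermitian x y.
have hyp (t : R) := pform_ge0 pa (x + (- (t%:C * a x y)) *: y).
have -> (z : R[i]) : `|z| ^+ 2 = z * z^* by exact: sqr_normc.
have := pform_ge0 pa x; have := pform_ge0 pa y; rewrite !complex_ge0.
move=> /andP[/eqP + +] /andP[/eqP + +].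
set N := complex.Re (a x y) * complex.Re (a x y)
  + complex.Im (a x y) * complex.Im (a x y).
have : forall t, 0 <= complex.Re (a x x) - 2 * t * N
    + t ^+ 2 * (N * complex.Re (a y y)).
  move=> t; have := hyp t; rewrite !(pformD, pformDr, pformZ, pformZr) hyx.
  rewrite complex_ge0 /N => /andP[_].
  have := pform_ge0 pa y; rewrite complex_ge0 => /andP[/eqP + _].
  case: (a x x) (a x y) (a y y) => [X X'] [u v] [Y Y'] /= ->; lra.
rewrite {}/N {hyx hyp}; case: (a x x) (a x y) (a y y) => [X X'] [u v] [Y Y'] /=.
set N := u * u + v * v => ht -> Y0 -> X0.
rewrite -subr_ge0 complex_ge0 /=; apply/andP; split; first by apply/eqP; lra.
suff : N <= X * Y by rewrite /N; lra.
have N0 : 0 <= N by rewrite /N -!expr2 addr_ge0 ?sqr_ge0.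
(* For [Y = 0] the polynomial is affine, and [t = (X + 1) / N] would give it the negative value
   [- X - 2]. Otherwise [t = 1 / Y] is its minimizer when [N] is nonzero. *)
have [Y00|Y00] := eqVneq Y 0.
  have [->|N00] := eqVneq N 0; first by rewrite Y00 mulr0.
  have := ht ((X + 1) / N); rewrite Y00 !mulr0 addr0 -mulrA mulfVK//; lra.
have Yp : 0 < Y by rewrite lt_def Y00.
have := ht Y^-1.
have -> : X - 2 * Y^-1 * N + Y^-1 ^+ 2 * (N * Y) = (X * Y - N) / Y by field.
by rewrite pmulr_lge0 ?invr_gt0// subr_ge0.
Qed.

End PositiveForm.

Lemma positive_formD (R : realType) (V : lmodType R[i]) (a b : V -> V -> R[i]) :
  positive_form a -> positive_form b -> positive_form (a + b).
Proof.
move=> pa pb; split=> [k x y z|k x y z|x]; rewrite !addrfctE.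
- by rewrite !(pform_linear pa, pform_linear pb); ring.
- by rewrite !(pform_antilinear pa, pform_antilinear pb); ring.
- by rewrite addr_ge0// (pform_ge0 pa, pform_ge0 pb).
Qed.

Lemma positive_formB (R : realType) (V : lmodType R[i]) (a b : V -> V -> R[i]) :
  positive_form a -> positive_form b ->
  (forall x, real_form b x x <= real_form a x x) -> positive_form (a - b).
Proof.
move=> pa pb ba; split=> [k x y z|k x y z|x]; rewrite !addrfctE !opprfctE.
- by rewrite !(pform_linear pa, pform_linear pb); ring.
- by rewrite !(pform_antilinear pa, pform_antilinear pb); ring.
- by rewrite !real_formE// subr_ge0 lecR.
Qed.

(** Polarization recovers the real part, and the real part at [i y] is the imaginary part at [y]. *)
Lemma positive_form_ext (R : realType) (V : lmodType R[i]) (a b : V -> V -> R[i]) :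
  positive_form a -> positive_form b ->
  (forall x, real_form a x x = real_form b x x) -> a = b.
Proof.
move=> pa pb ab.
have re_ab x y : real_form a x y = real_form b x y.
  have := ab (x + y); have := ab x; have := ab y.
  have sa := real_form_symmetric pa; have sb := real_form_symmetric pb.
  rewrite !(sformE sa, sformE sb) (sformC sa y) (sformC sb y); lra.
apply/funext => x; apply/funext => y; apply/eqP; rewrite eq_complex.
apply/andP; split; apply/eqP; first exact: re_ab.
have := re_ab x ('i%C *: y); rewrite /real_form (pformZr pa) (pformZr pb).
by case: (a x y) (b x y) => [u v] [u' v'] /=; lra.
Qed.

Lemma eq_complexP (R : realType) (z w : R[i]) :
  complex.Re z = complex.Re w -> complex.Im z = complex.Im w -> z = w.
Proof. by case: z w => [? ?] [? ?] /= -> ->. Qed.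

Lemma scaler_ii (R : realType) (V : lmodType R[i]) (x : V) :
  'i%C *: ('i%C *: x) = - x.
Proof.
rewrite scalerA -[RHS]scaleN1r; congr (_ *: _).
by apply: eq_complexP => /=; ring.
Qed.

Section Complexification.
Variables (R : realType) (V : lmodType R[i]).
Variable c : realification V -> realification V -> R.
Hypotheses (sc : sym_bilinear c) (c_ge0 : forall x, 0 <= c x x).
Hypothesis c_i : forall x : V, c ('i%C *: x) ('i%C *: x) = c x x.

(** A form antilinear in its second variable satisfies [Im a(x, y) = Re a(x, i y)], so no other
    sesquilinear form can have real part [c]. *)
Definition complexify (x y : V) : R[i] := c x y +i* c x ('i%C *: y).

Let c_ii (x y : V) : c ('i%C *: x) ('i%C *: y) = c x y.
Proof.
have := c_i (x + y); rewrite scalerDr; have := c_i x; have := c_i y.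
rewrite !(sformE sc) (sformC sc y) (sformC sc ('i%C *: y : V)); lra.
Qed.

Let scale_complex (k : R[i]) (x : V) :
  k *: x = complex.Re k *: (x : realification V)
           + complex.Im k *: ('i%C *: x : realification V) :> realification V.
Proof.
case: k => u v; change ((u +i* v) *: x = u%:C *: x + v%:C *: ('i%C *: x)).
rewrite scalerA -scalerDl; congr (_ *: _).
by apply: eq_complexP => /=; ring.
Qed.

Let c_il (x y : V) : c ('i%C *: x) y = - c x ('i%C *: y).
Proof. by rewrite -c_ii scaler_ii (sformN sc). Qed.

Lemma complexify_positive : positive_form complexify.
Proof.
split=> [k x y z|k x y z|x].
- rewrite /complexify (sformD sc) (sformD sc _ y) (scale_complex k x).
  rewrite !(sformD sc, sformZ sc) !c_il scaler_ii (sformNr sc).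
  by case: k => u v; apply: eq_complexP => /=; ring.
- rewrite /complexify [_ *: (_ + _)]scalerDr scalerA (mulrC 'i%C) -scalerA.
  rewrite (sformDr sc) (sformDr sc _ _ (_ *: y)).
  rewrite (scale_complex k x) (scale_complex k (_ *: x)) scaler_ii.
  rewrite !(sformDr sc, sformZr sc, sformNr sc).
  by case: k => u v; apply: eq_complexP => /=; ring.
- rewrite complex_ge0 /= c_ge0 andbT; apply/eqP.
  by have := c_il x x; rewrite (sformC sc ('i%C *: x : V)); lra.
Qed.

End Complexification.

(** The real conjugate inherits invariance under multiplication by [i] from [a] and [b], by the
    change of variable from [x] to [- i x]; hence it complexifies. One inequality suffices, since
    applying it at [i y] reverses it. *)
Lemma positive_conjugate_exists (R : realType) (V : lmodType R[i])
    (a b : V -> V -> R[i]) :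
  positive_form a -> positive_form b ->
  (forall y, exists M, forall x, 2 * real_form b x y - real_form a x x <= M) ->
  exists c, positive_form c /\
    fenchel_conjugate (real_form a) (real_form b) (real_form c).
Proof.
move=> pa pb bnd.
have [c [sc c0 cc]] := fenchel_conjugate_exists (real_form_symmetric pa)
  (real_form_symmetric pb) (real_form_ge0 pa) bnd.
have c_le (y : V) : c ('i%C *: y) ('i%C *: y) <= c y y.
  apply/ler_addgt0Pr => e /(cc.2 ('i%C *: y))[x].
  have := cc.1 (- ('i%C *: (x : V))) y.
  by rewrite -(real_form_i pb) -(real_form_i pa) scalerN scaler_ii opprK; lra.
exists (complexify c); split; last exact: cc.
apply: complexify_positive => // x; apply/eqP; rewrite eq_le c_le/=.
have := c_le ('i%C *: x); rewrite scaler_ii; apply: le_trans.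
by rewrite (sformN sc) (sformNr sc) opprK.
Qed.

(** * Continuity into the strong anti-dual *)

Section SeminormedTopology.
Variables (C : numFieldType) (V : lmodType C) (P : set (V -> C)).

Lemma open_seminorm_ball (p : V -> C) (x : V) (e : C) : P p -> 0 < e ->
  open ([set y | p (y - x) < e] : set (seminormed P)).
Proof.
move=> Pp e0; pose B := [set y | p (y - x) < e].
exists [set B]; last by rewrite bigcup_set1.
by move=> _ ->; apply: (@finI_from1 _ _ _ id); exists p, x, e.
Qed.

(** The preimage of a subbasic ball under a translation is a ball with shifted centre. This reduces
    continuity at a point to neighbourhoods of 0. *)
Lemma translation_continuous (x : V) :
  continuous ((fun y => y - x) : seminormed P -> seminormed P).
Proof.
move=> y U; rewrite /= nbhsE => -[B [[D' sD <-] [A DA Ay]] sU].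
have [F sF AF] := sD _ DA.
apply: filterS (_ : nbhs y (fun z : seminormed P => A (z - x))).
  by move=> z Az; apply: sU; exists A.
rewrite -AF; apply: filter_bigI => B' B'F.
have /set_mem[p [x0 [e [Pp e0 B'E]]]] := sF _ B'F.
rewrite -AF in Ay; have := Ay _ B'F; rewrite B'E /= -addrA -opprD => h.
apply: filterS (open_nbhs_nbhs (conj (open_seminorm_ball (x + x0) Pp e0) h)).
by move=> z /=; rewrite opprD addrA.
Qed.

Lemma nbhs_translate (x : V) (U : set (seminormed P)) :
  nbhs (0 : seminormed P) U -> nbhs (x : seminormed P) [set y | U (y - x)].
Proof.
move=> U0; apply: (@translation_continuous x x).
by rewrite /= -[X in nbhs X]/(x - x : V) subrr.
Qed.

End SeminormedTopology.

Section RiggedOperators.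
Variables (R : realType) (H : completeNormedModType R[i]) (S : {pred H}).
Variables (D : subLmodType S) (AA : set (D -> D)).

Lemma antilinear_continuous (phi : D -> R[i]) :
  (forall (a : R[i]) (x y : D), phi (a *: x + y) = a^* * phi x + phi y) ->
  (forall e : R[i], 0 < e -> nbhs (0 : Dtau AA) [set y : D | `|phi y| <= e]) ->
  antidual AA phi.
Proof.
move=> phiP phi0; split=> // x.
apply/(@cvgrPdist_le _ R[i] _ (nbhs (x : Dtau AA)) _ phi (phi x)) => e e0.
have hx : nbhs (x : Dtau AA) [set y : Dtau AA | `|phi (y - x)| <= e].
  exact: nbhs_translate (phi0 e e0).
apply: filterS hx => y /=; rewrite distrC (addrC y) -scaleN1r phiP.
by rewrite rmorphN rmorph1 mulN1r addrC.
Qed.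

Lemma closed_antidual_ball (phi : D -> R[i]) (r : R[i]) :
  antidual AA phi -> closed ([set y | `|phi y| <= r] : set (Dtau AA)).
Proof.
move=> [_ phiC] y cly; apply/ler_addgt0Pr => e e0.
have /(@cvgrPdist_le _ R[i] _ (nbhs (y : Dtau AA))) /(_ e e0) := phiC y.
move=> /cly[z [zr ze]].
rewrite -(subrK (phi z) (phi y)) (le_trans (ler_normD _ _))// addrC.
by rewrite lerD.
Qed.

Lemma antidualD (phi : D -> R[i]) x y : antidual AA phi ->
  phi (x + y) = phi x + phi y.
Proof. by move=> [h _]; rewrite -{1}(scale1r x) h conjC1 mul1r. Qed.

Lemma antidualZ (phi : D -> R[i]) a x : antidual AA phi ->
  phi (a *: x) = a^* * phi x.
Proof.
move=> h; have phi0 : phi 0 = 0.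
  by have := antidualD 0 0 h; rewrite addr0 -[LHS]addr0 => /addrI.
by rewrite -[a *: x]addr0 h.1 phi0 addr0.
Qed.

Hypothesis barD : barrelled (Dtau AA).

(** Banach-Steinhaus: the polar of [F] is a barrel. It is absorbing by pointwise boundedness and
    closed as an intersection of closed sets. *)
Lemma equicontinuous (F : set (D -> R[i])) (e : R[i]) :
  F `<=` antidual AA ->
  (forall x, exists M : R[i], forall phi, F phi -> `|phi x| <= M) ->
  0 < e -> nbhs (0 : Dtau AA) [set x : D | forall phi, F phi -> `|phi x| <= e].
Proof.
move=> FA FM e0; apply: barD; split.
- move=> a b x y ab xF yF phi Fphi.
  rewrite (antidualD _ _ (FA _ Fphi)) !(antidualZ _ _ (FA _ Fphi)).
  rewrite (le_trans (ler_normD _ _))// !normrM !norm_conjC.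
  rewrite (@le_trans _ _ (`|a| * e + `|b| * e))//.
    by rewrite lerD// ler_wpM2l//; [exact: xF|exact: yF].
  by rewrite -mulrDl ler_piMl// ltW.
- move=> x; have [M hM] := FM x; have M0 : 0 < `|M| + 1 by rewrite ltr_wpDl.
  exists (e / (`|M| + 1)); first by rewrite divr_gt0.
  move=> a ae phi Fphi; rewrite (antidualZ _ _ (FA _ Fphi)) normrM norm_conjC.
  have phiM : `|phi x| <= `|M| + 1.
    have M_ge0 : 0 <= M := le_trans (normr_ge0 _) (hM _ Fphi).
    by rewrite (le_trans (hM _ Fphi))// ger0_norm// lerDl.
  by rewrite (le_trans (ler_pM _ _ ae phiM))// divfK// gt_eqF.
- rewrite (_ : mkset _ = \bigcap_(phi in F) [set x | `|phi x| <= e]).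
    by apply: closed_bigI => phi Fphi; exact/closed_antidual_ball/FA.
  by apply/seteqP; split.
Qed.

(** Separate continuity becomes joint continuity: the functionals [s x] with [s x x <= 1] are
    pointwise bounded by Cauchy-Schwarz, hence equicontinuous. *)
Lemma antidual_form_small (s : D -> D -> R[i]) (e : R[i]) :
  positive_form s -> (forall x, antidual AA (s x)) -> 0 < e ->
  nbhs (0 : Dtau AA) [set y : D | s y y <= e].
Proof.
move=> ps As e0; pose F := [set s x | x in [set x : D | s x x <= 1]].
have FA : F `<=` antidual AA by move=> _ [x _ <-].
have FM x : exists M : R[i], forall phi, F phi -> `|phi x| <= M.
  exists (sqrtC (s x x)) => _ [y y1 <-].
  rewrite -(@ler_pXn2r _ 2) ?nnegrE ?sqrtC_ge0 ?(pform_ge0 ps)//.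
  rewrite sqrtCK (le_trans (cauchy_schwarz ps _ _))// ler_piMl//.
  exact: pform_ge0 ps _.
have e'0 : 0 < sqrtC e by rewrite sqrtC_gt0.
apply: filterS (equicontinuous FA FM e'0) => y /= hy.
have [->|y0] := eqVneq (s y y) 0; first exact: ltW.
have t0 : 0 < s y y by rewrite lt_def y0 (pform_ge0 ps).
pose r := sqrtC (s y y); have r0 : 0 < r by rewrite sqrtC_gt0.
have rV0 : 0 <= r^-1 by rewrite invr_ge0 ltW.
have rr : r * r = s y y by rewrite -expr2 sqrtCK.
suff : r <= sqrtC e.
  by move=> re; rewrite -[s y y]sqrtCK -[e]sqrtCK ler_pXn2r// nnegrE ltW.
(* The vector [y / r] has [s]-norm 1, so its functional lies in [F] and attains [r] at [y]. *)
have -> : r = `|s (r^-1 *: y) y|.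
  by rewrite (pformZ ps) -rr mulKf ?gt_eqF// ger0_norm ?ltW.
apply: hy; exists (r^-1 *: y) => //=.
rewrite (pformZ ps) (pformZr ps) (geC0_conj rV0) -rr.
by rewrite mulKf ?gt_eqF// mulVf ?gt_eqF.
Qed.

Lemma form_antidual (c : D -> D -> R[i]) x : positive_form c ->
  (forall e : R[i], 0 < e -> nbhs (0 : Dtau AA) [set y : D | c y y <= e]) ->
  antidual AA (c x).
Proof.
move=> pc c_small; apply: antilinear_continuous => [a y z|e e0].
  exact: pform_antilinear.
(* Adding 1 keeps the denominator positive when [c x x = 0]. *)
have c1 : 0 < c x x + 1 by rewrite ltr_wpDl// (pform_ge0 pc).
have d0 : 0 < e ^+ 2 / (c x x + 1) by rewrite divr_gt0// exprn_gt0.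
apply: filterS (c_small _ d0) => y /= hy.
have e_ge0 := ltW e0.
rewrite -(@ler_pXn2r _ 2) ?nnegrE// (le_trans (cauchy_schwarz pc _ _))//.
have cx : c x x <= c x x + 1 by rewrite lerDl.
rewrite (le_trans (ler_pM _ _ cx hy)) ?(pform_ge0 pc)//.
by rewrite mulrC divfK// gt_eqF.
Qed.

(* The strong neighbourhood given by a weakly bounded [B] pulls back to a
   polar of [c @` B], because [c] is hermitian. *)
Lemma form_Lop (c : D -> D -> R[i]) : positive_form c ->
  (forall x, antidual AA (c x)) -> Lop AA c.
Proof.
move=> pc Ac; split=> //.
  by move=> a x y; apply/funext => z; exact: (pform_linear pc).
move=> x; have xF : Filter (nbhs (x : Dtau AA)) := @nbhs_filter (Dtau AA) x.
pose G := fmap (c : Dtau AA -> (D -> R[i])) (nbhs (x : Dtau AA)).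
have GF : Filter G.
  exact: (@fmap_filter (Dtau AA) (D -> R[i]) c (nbhs (x : Dtau AA)) xF).
apply/(@fam_cvgP D R[i] (weakly_bounded AA) G (c x) GF) => B wB.
move=> U /uniform_nbhs[E [+ EU]].
rewrite -entourage_from_ballE => -[e /= e0 eE].
have e20 : 0 < e / 2 by rewrite divr_gt0.
pose F := [set c y | y in B].
have FA : F `<=` antidual AA by move=> _ [y _ <-].
have FM z : exists M : R[i], forall phi, F phi -> `|phi z| <= M.
  have [M hM] := wB _ (Ac z); exists M => _ [y By <-].
  by rewrite (pform_hermitian pc) norm_conjC hM.
have hx : nbhs (x : Dtau AA) [set z : Dtau AA |
    forall phi, F phi -> `|phi (z - x)| <= e / 2].
  exact: nbhs_translate (equicontinuous FA FM e20).
apply: filterS hx => z hz; apply: EU => y By; apply: eE.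
rewrite -ball_normE /= distrC -normrN opprB.
have h : c (x - z) y = c x y - c z y.
  by rewrite -scaleN1r addrC (pform_linear pc) mulN1r addrC.
rewrite -h (pform_hermitian pc) norm_conjC.
have : `|c y (z - x)| <= e / 2 by apply: hz; exists y.
rewrite -opprB -scaleN1r (pformZr pc) normrM norm_conjC normrN1 mul1r.
by move=> /le_lt_trans; apply; rewrite ltr_pdivrMr// ltr_pMr// ltr1n.
Qed.

(** This places both conjugates and both parts of [A] in [Lop], with [s] the form of [I + A]. *)
Lemma dominated_form_Lop (s c : D -> D -> R[i]) :
  (forall e : R[i], 0 < e -> nbhs (0 : Dtau AA) [set y : D | s y y <= e]) ->
  positive_form c -> (forall x, c x x <= s x x) -> Lop AA c.
Proof.
move=> s_small pc cs; apply: form_Lop => // x; apply: form_antidual => // e e0.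
by apply: filterS (s_small e e0) => y /=; exact: le_trans.
Qed.

End RiggedOperators.

(** * Complements and the decomposition *)

Section Complement.
Variables (R : realType) (H : completeNormedModType R[i]) (S : {pred H}).
Variables (D : subLmodType S) (AA : set (D -> D)).
Implicit Types a b c : D -> D -> R[i].

Lemma Lop_positive_form a : Lop AA a -> posop a -> positive_form a.
Proof.
move=> [Aa La _] a_ge0; split => // [k x y z|k x y z].
  by rewrite La.
exact: (Aa z).1.
Qed.

Lemma opmxE a b c (u : D * D) :
  positive_form a -> positive_form b -> positive_form c ->
  opmx a b b c u u = (real_form a u.1 u.1 + 2 * real_form b u.1 u.2
    + real_form c u.2 u.2)%:C.
Proof.
move=> pa pb pc; rewrite /opmx !addrfctE (real_formE pa) (real_formE pc).
rewrite (pform_hermitian pb u.1 u.2) /real_form.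
by case: (b _ _) => v w; apply: eq_complexP => /=; ring.
Qed.

(** Positivity of the matrix at [(- x, y)] reads [2 b(x, y) - a[x] <= c[y]], so the candidates are
    the positive operators lying above the supremum. *)
Lemma fenchel_is_complement a b c :
  positive_form a -> positive_form b -> positive_form c -> Lop AA c ->
  fenchel_conjugate (real_form a) (real_form b) (real_form c) ->
  is_complement AA a b c.
Proof.
move=> pa pb pc Lc cc; split.
  split=> //; first exact: pform_ge0 pc.
  move=> u; rewrite opmxE// lecR.
  have := cc.1 (- u.1) u.2.
  have sa := real_form_symmetric pa; have sb := real_form_symmetric pb.
  by rewrite !(sformE sa, sformE sb); lra.
move=> c' [Lc' c'0 m0] y; have pc' := Lop_positive_form Lc' c'0.
rewrite !addrfctE !opprfctE (real_formE pc) (real_formE pc') subr_ge0 lecR.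
apply/ler_addgt0Pr => e /(cc.2 y)[x].
have := m0 (- x, y); rewrite opmxE// lecR /=.
have sa := real_form_symmetric pa; have sb := real_form_symmetric pb.
by rewrite !(sformE sa, sformE sb); lra.
Qed.

(** Two complements lie below each other, so they agree on the diagonal, hence everywhere; [xget]
    has only one value to choose. *)
Lemma complement_eq a b c : is_complement AA a b c -> complement AA a b = c.
Proof.
move=> hc; apply: xget_unique => // c' hc'.
have [[Lc c0 mc] lec] := hc; have [[Lc' c'0 mc'] lec'] := hc'.
have pc := Lop_positive_form Lc c0; have pc' := Lop_positive_form Lc' c'0.
apply: positive_form_ext => // x.
have := lec c' hc'.1 x; have := lec' c hc.1 x.
rewrite !addrfctE !opprfctE (real_formE pc) (real_formE pc') !subr_ge0 !lecR.
by move=> h1 h2; apply/eqP; rewrite eq_le h1.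
Qed.

End Complement.

Section NaturalInclusion.
Variables (R : realType) (H : completeNormedModType R[i]).
Variables (dot : {dot H for (@Num.conj R[i])}) (S : {pred H}).
Variables (D : subLmodType S) (AA : set (D -> D)).
Hypothesis dotE : norm_of_dot dot.

Lemma natural_inclusion_positive : positive_form (natural_inclusion dot D).
Proof.
split=> [k x y z|k x y z|x]; rewrite /natural_inclusion.
- by rewrite raddfD /= linearZ /= linearPl.
- by rewrite raddfD /= linearZ /= linearPr.
- by rewrite dotE exprn_ge0.
Qed.

(** The graph seminorm of the identity dominates the Hilbert norm. *)
Lemma natural_inclusion_small (e : R[i]) : AA id -> 0 < e ->
  nbhs (0 : Dtau AA) [set y : D | natural_inclusion dot D y y <= e].
Proof.
move=> AAid e0; have e'0 : 0 < sqrtC e by rewrite sqrtC_gt0.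
have Pid : [set graph_seminorm T | T in AA] (graph_seminorm (D := D) id).
  by exists id.
have b0 : graph_seminorm (D := D) id ((0 : D) - (0 : D)) < sqrtC e.
  by rewrite subrr /graph_seminorm /= raddf0 normr0 expr0n addr0 sqrtC0.
have hn := open_nbhs_nbhs (conj (open_seminorm_ball (0 : D) Pid e'0) b0).
apply: filterS hn => y /=; rewrite subr0 /graph_seminorm /natural_inclusion.
have e_ge0 := ltW e0.
rewrite dotE ltr_sqrtC ?nnegrE ?addr_ge0 ?exprn_ge0// => h.
by apply/ltW/(le_lt_trans _ h); rewrite lerDl exprn_ge0.
Qed.

End NaturalInclusion.

(** * Null sequences of complex numbers in real terms *)

Section ComplexSequences.
Variable R : realType.

Lemma gt0_complex (z : R[i]) : 0 < z -> exists2 r : R, 0 < r & z = r%:C.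
Proof. by case: z => a b /andP[/= /eqP -> a0]; exists a. Qed.

Lemma cvg_complex0P (u : nat -> R[i]) (r : nat -> R) :
  (forall n, `|u n| = (r n)%:C) ->
  (u n @[n --> \oo] --> (0 : R[i])) <->
  (forall e : R, 0 < e -> exists N, forall n, (N <= n)%N -> r n <= e).
Proof.
move=> ur; split=> [/cvgrPdist_le u0 e e0|r0].
  have := u0 e%:C; rewrite ltcR => /(_ e0)[N _ hN]; exists N => n Nn.
  by have := hN n Nn; rewrite /= sub0r normrN ur lecR.
apply/cvgrPdist_le => eps /gt0_complex[e e0 ->].
have [N hN] := r0 e e0; exists N => // n /= Nn.
by rewrite sub0r normrN ur lecR hN.
Qed.

Lemma cvg2_complex0 (u : nat -> nat -> R[i]) (r : nat -> nat -> R) :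
  (forall n m, `|u n m| = (r n m)%:C) ->
  u nm.1 nm.2 @[nm --> (\oo, \oo)] --> (0 : R[i]) ->
  forall e : R, 0 < e ->
    exists N, forall n m, (N <= n)%N -> (N <= m)%N -> r n m <= e.
Proof.
move=> ur /cvgrPdist_le u0 e e0.
have := u0 e%:C; rewrite ltcR => /(_ e0)[[P Q] /= [[N1 _ h1] [N2 _ h2]] PQ].
exists (maxn N1 N2) => n m; rewrite !geq_max => /andP[n1 _] /andP[_ m2].
have := PQ (n, m) (conj (h1 n n1) (h2 m m2)).
by rewrite /= sub0r normrN ur lecR.
Qed.

Lemma norm_positive_form (V : lmodType R[i]) (c : V -> V -> R[i]) x :
  positive_form c -> `|c x x| = (real_form c x x)%:C.
Proof. by move=> pc; rewrite ger0_norm ?(pform_ge0 pc)// (real_formE pc). Qed.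

End ComplexSequences.

Section Decomposition.
Variables (R : realType) (H : completeNormedModType R[i]).
Variables (dot : {dot H for (@Num.conj R[i])}) (S : {pred H}).
Variables (D : subLmodType S) (AA : set (D -> D)).
Hypothesis dotE : norm_of_dot dot.
Local Notation h := (natural_inclusion dot D).

(** [regular] and [singular] speak of the Hilbert norm, the real estimates of its square; hence the
    thresholds [Num.sqrt e] and [e ^+ 2]. *)
Lemma cvg_norm0P (x_ : nat -> D) :
  (`|val (x_ n) : H| @[n --> \oo] --> (0 : R[i])) <->
  (forall e : R, 0 < e -> exists N, forall n, (N <= n)%N ->
     real_form h (x_ n) (x_ n) <= e).
Proof.
pose r n := complex.Re `|val (x_ n) : H|.
have rE n : `|val (x_ n) : H| = (r n)%:C.
  by have := normr_ge0 (val (x_ n) : H); rewrite complex_ge0 /r;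
    case: `|_| => a b /= /andP[/eqP -> _].
have r_ge0 n : 0 <= r n by have := normr_ge0 (val (x_ n) : H); rewrite rE lecR.
have hE n : real_form h (x_ n) (x_ n) = r n ^+ 2.
  by rewrite /real_form /natural_inclusion dotE rE -rmorphXn.
rewrite (@cvg_complex0P _ (fun n => `|val (x_ n) : H|) r); last first.
  by move=> n; rewrite normr_id rE.
split=> r0 e e0.
  have se : 0 < Num.sqrt e by rewrite sqrtr_gt0.
  have [N hN] := r0 _ se; exists N => n Nn; rewrite hE -(sqr_sqrtr (ltW e0)).
  by rewrite ler_pXn2r// ?nnegrE ?sqrtr_ge0// hN.
have [N hN] := r0 _ (exprn_gt0 2 e0); exists N => n Nn.
by have := hN n Nn; rewrite hE ler_pXn2r ?nnegrE// ltW.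
Qed.

End Decomposition.

Theorem theorem3p3 (R : realType) (H : completeNormedModType R[i])
    (dot : {dot H for (@Num.conj R[i])}) (S : {pred H}) (D : subLmodType S)
    (AA : set (D -> D)) (A : D -> D -> R[i]) :
  norm_of_dot dot ->
  dense [set x | x \in S] ->
  unital_dagger_subalgebra dot AA ->
  barrelled (Dtau AA) ->
  Lop AA A -> posop A ->
  let I := natural_inclusion dot D in
  let IA := parallel_sum AA I A in
  let Ar := complement AA (I - IA) I - I in
  [/\ is_complement AA (I + A) I (complement AA (I + A) I),
      is_complement AA (I - IA) I (complement AA (I - IA) I) &
      lebesgue_decomposition AA A Ar (A - Ar)].
Proof.
move=> dotE _ /uds_id AAid barD LA A0 I.
have pI : positive_form I := natural_inclusion_positive D dotE.
have pA := Lop_positive_form LA A0.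
have ps := positive_formD pI pA; set s := I + A in ps *.
have s_small (e : R[i]) : 0 < e -> nbhs (0 : Dtau AA) [set y : D | s y y <= e].
  move=> e0; have e20 : 0 < e / 2 by rewrite divr_gt0.
  have [As _ _] := LA.
  have hI := natural_inclusion_small dotE AAid e20.
  have hA := antidual_form_small barD pA As e20.
  apply: filterS (filterI hI hA) => y [/= hIy hAy].
  by rewrite (splitr e) lerD.
have le_s (c : D -> D -> R[i]) : positive_form c ->
    (forall x, real_form c x x <= real_form s x x) -> Lop AA c.
  move=> pc cs; apply: (dominated_form_Lop barD s_small pc) => x.
  by rewrite (real_formE pc) (real_formE ps) lecR.
have symI := real_form_symmetric pI; have I0 := real_form_ge0 pI.
have sE x : real_form s x x = real_form I x x + real_form A x x.
  by rewrite /real_form /s !addrfctE; case: (I x x) (A x x) => [? ?] [].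
have I_le_s x : real_form I x x <= real_form s x x.
  by rewrite sE lerDl (real_form_ge0 pA).
(* The two boundedness conditions make the suprema finite: the first is Young's inequality, the
   second is the definition of [c1] with the variables exchanged. *)
have bnd1 y : exists M, forall x, 2 * real_form I x y - real_form s x x <= M.
  exists (real_form I y y) => x; have := young_form symI I0 x y ltr01.
  by have := I_le_s x; lra.
have [c1 [pc1 cc1]] := positive_conjugate_exists ps pI bnd1.
have bnd2 y : exists M, forall x, 2 * real_form I x y - real_form c1 x x <= M.
  exists (real_form s y y) => x; have := cc1.1 y x.
  by rewrite (sformC symI y); lra.
have [c2 [pc2 cc2]] := positive_conjugate_exists pc1 pI bnd2.
have c1_le_I := conjugate_le_form symI I0 I_le_s cc1.
have I_le_c2 := form_le_biconjugate symI I0 I_le_s cc1 cc2.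
have c2_le_s := biconjugate_le symI cc1 cc2.
have Lc1 : Lop AA c1 by apply: le_s => // x; exact: le_trans (I_le_s x).
have comp1 := fenchel_is_complement ps pI pc1 Lc1 cc1.
have comp2 := fenchel_is_complement pc1 pI pc2 (le_s _ pc2 c2_le_s) cc2.
(* Here [I - IA = I - (I - c1) = c1], so the second complement is that of [c1]. *)
rewrite /parallel_sum -/s (complement_eq comp1) opprB addrC subrK.
rewrite (complement_eq comp2).
have par := positive_formB pc2 pI I_le_c2.
have pas : positive_form (A - (c2 - I)).
  (* The singular part [A - (c2 - I)] is [s - c2]. *)
  rewrite opprB addrA (addrC A); exact: positive_formB ps pc2 c2_le_s.
have arE x : real_form (c2 - I) x x = real_form c2 x x - real_form I x x.
  by rewrite /real_form !addrfctE !opprfctE; case: (c2 x x) (I x x) => [? ?] [].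
have asE x : real_form (A - (c2 - I)) x x = real_form s x x - real_form c2 x x.
  rewrite opprB addrA (addrC A) /real_form /s !addrfctE !opprfctE.
  by case: (I x x) (A x x) (c2 x x) => [? ?] [? ?] [].
split => //; split; first by rewrite addrC subrK.
- split; [apply: le_s => // x; rewrite arE|exact: pform_ge0 par|].
    by have := c2_le_s x; have := I0 x; lra.
  move=> x_ /(cvg_norm0P dotE) x0 xx0.
  have xC := @cvg2_complex0 R (fun n m => (c2 - I) (x_ n - x_ m) (x_ n - x_ m))
    _ (fun n m => norm_positive_form _ par) xx0.
  apply/(cvg_complex0P (fun n => norm_positive_form (x_ n) par)) => e e0.
  have [] := regular_part_closable symI I0 cc2 x0 _ e0.
    by move=> d /xC[N hN]; exists N => n m Nn Nm; rewrite -arE; exact: hN.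
  (* The lemma bounds [c2], which dominates [c2 - I]. *)
  move=> N hN; exists N => n /hN; rewrite arE; apply: le_trans.
  by rewrite gerBl.
- split; [apply: le_s => // x; rewrite asE|exact: pform_ge0 pas|].
    by have := real_form_ge0 pc2 x; lra.
  move=> y.
  (* Approximants with error [1 / (n + 1)] form the sequence that singularity asks for. *)
  have /choice[z hz] : forall n, exists z : D,
      real_form I (y - z) (y - z) <= n.+1%:R^-1 /\
      real_form s z z - real_form c2 z z <= n.+1%:R^-1.
    move=> n; apply: (singular_part_approx symI I0 I_le_s
      (real_form_symmetric pc1) (real_form_ge0 pc1) cc1 cc2).
    by rewrite invr_gt0.
  have inv_small (e : R) : 0 < e ->
      exists N, forall n, (N <= n)%N -> n.+1%:R^-1 <= e.
    move=> e0; exists (Num.bound e^-1) => n Nn.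
    rewrite -[leRHS]invrK lef_pV2 ?posrE ?invr_gt0//.
    rewrite ltW// (lt_le_trans (archi_boundP _)) ?invr_ge0 ?ltW// ltr_nat.
    by rewrite ltnS.
  exists z; split.
    apply/(cvg_norm0P dotE) => e /inv_small[N hN]; exists N => n /hN.
    apply: le_trans; have [+ _] := hz n.
    by rewrite -opprB (sformN symI) (sformNr symI) opprK.
  apply/(cvg_complex0P (fun n => norm_positive_form (z n) pas)).
  move=> e /inv_small[N hN]; exists N => n /hN; apply: le_trans.
  by rewrite asE; have [] := hz n.
Qed.
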